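(* Let $f$ be a slice regular function defined on a symmetric domain $\Omega_D$ and let $q_0\in\Omega_D\setminus\mathbb{R}$. Let $(s_n)_{n\ge0}$ be the spherical coefficients of $f$ at $q_0$ and let $(s_n')_{n\ge 0}$ be the spherical coefficients at $q_0$ of the slice derivative $\partial_c f$. Then, for every integer $k\ge0$, $$s'_{2k}=(2k+1)s_{2k+1}+2(k+1)\operatorname{Im}(q_0)\,s_{2k+2},$$ $$s'_{2k+1}=(2k+2)s_{2k+2}-2(k+1)\operatorname{Im}(q_0)\,s_{2k+3}.$$
   Context: Quaternions: $\mathbb{H}$ is the algebra of quaternions, $x^c$ the conjugate of $x$, $\operatorname{Re}(x)=(x+x^c)/2$, $\operatorname{Im}(x)=(x-x^c)/2$ (so $\operatorname{Im}(x)$ is a purely imaginary quaternion), $\mathbb{S}=\{x\in\mathbb{H}: x^2=-1\}$. Every $x\in\mathbb{H}$ is $x=\alpha+I\beta$ with $\alpha,\beta\in\mathbb{R}$, $\beta\ge0$, $I\in\mathbb{S}$. Symmetric domains and slice functions: let $D\subset\mathbb{C}$ be open with $D=\overline{D}$ (invariant under complex conjugation; it may be disconnected, e.g. $D=\mathbb{C}\setminus\mathbb{R}$). Its circularization $\Omega_D=\{\alpha+I\beta: \alpha+i\beta\in D,\ I\in\mathbb{S}\}$ is called a symmetric domain. A stem function is $F=F_0+\sqrt{-1}F_1:D\to\mathbb{H}\otimes\mathbb{C}$ with $F_0,F_1:D\to\mathbb{H}$, $F_0(\bar z)=F_0(z)$, $F_1(\bar z)=-F_1(z)$. It induces the slice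 function $f=\mathcal{I}(F):\Omega_D\to\mathbb{H}$, $f(\alpha+I\beta)=F_0(\alpha+i\beta)+I F_1(\alpha+i\beta)$. $f$ is slice regular if $F$ is $C^1$ and holomorphic, i.e. $\partial_\alpha F_0=\partial_\beta F_1$ and $\partial_\beta F_0=-\partial_\alpha F_1$. Slice derivative: for $f=\mathcal{I}(F)$ with $F$ of class $C^1$, $\partial_c f=\mathcal{I}(\partial F/\partial z)$, i.e. $(\partial_c f)(\alpha+I\beta)=\frac12\left(\frac{\partial}{\partial\alpha}-I\frac{\partial}{\partial\beta}\right)(F_0+IF_1)(\alpha+i\beta)$. If $f$ is slice regular, so is $\partial_c f$. Spherical expansion: for $q_0\in\mathbb{H}\setminus\mathbb{R}$, $\Delta_{q_0}(x)=x^2-2x\operatorname{Re}(q_0)+|q_0|^2$. It is known that for $g$ slice regular on $\Omega_D$ and $q_0\in\Omega_D\setminus\mathbb{R}$ there are $r>0$ with $U(q_0,r)=\{x\in\mathbb{H}:|\Delta_{q_0}(x)|<r^2\}\subset\Omega_D$ and unique $c_n\in\mathbb{H}$ such that $g(x)=\sum_{n\ge0}\Delta_{q_0}^n(x)[c_{2n}+(x-q_0)c_{2n+1}]$ for all $x\in U(q_0,r)$; the $c_n$ are the spherical coefficients of $g$ at $q_0$. *)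

(* Defs.v *)
From Stdlib Require Import Reals Lra.
From Coquelicot Require Import Coquelicot.

Open Scope R_scope.

(* ((a, b), c, d) stands for a + b i + c j + d k. *)
Definition Quat : Type := (R * R * R * R)%type.

Definition q_re (x : Quat) : R := fst (fst (fst x)).
Definition q_i (x : Quat) : R := snd (fst (fst x)).
Definition q_j (x : Quat) : R := snd (fst x).
Definition q_k (x : Quat) : R := snd x.

Canonical Quat_UniformSpace :=
  UniformSpace.Pack Quat (UniformSpace.class
    (prod_UniformSpace (prod_UniformSpace
       (prod_UniformSpace R_UniformSpace R_UniformSpace)
       R_UniformSpace) R_UniformSpace)) Quat.

Canonical Quat_AbelianGroup :=
  AbelianGroup.Pack Quat (AbelianGroup.class
    (prod_AbelianGroup (prod_AbelianGroup
       (prod_AbelianGroup R_AbelianGroup R_AbelianGroup)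
       R_AbelianGroup) R_AbelianGroup)) Quat.

Definition Quat_real_space : NormedModule R_AbsRing :=
  prod_NormedModule R_AbsRing (prod_NormedModule R_AbsRing
    (prod_NormedModule R_AbsRing R_NormedModule R_NormedModule)
    R_NormedModule) R_NormedModule.

Canonical Quat_ModuleSpace :=
  ModuleSpace.Pack R_Ring Quat (ModuleSpace.class R_Ring Quat_real_space) Quat.

Canonical Quat_NormedModuleAux :=
  NormedModuleAux.Pack R_AbsRing Quat
    (NormedModuleAux.class R_AbsRing Quat_real_space) Quat.

Canonical Quat_NormedModule :=
  NormedModule.Pack R_AbsRing Quat
    (NormedModule.class R_AbsRing Quat_real_space) Quat.

Definition quat_mult (x y : Quat) : Quat :=
  (q_re x * q_re y - q_i x * q_i y - q_j x * q_j y - q_k x * q_k y,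
   q_re x * q_i y + q_i x * q_re y + q_j x * q_k y - q_k x * q_j y,
   q_re x * q_j y - q_i x * q_k y + q_j x * q_re y + q_k x * q_i y,
   q_re x * q_k y + q_i x * q_j y - q_j x * q_i y + q_k x * q_re y).

Definition quat_of_R (a : R) : Quat := (a, 0, 0, 0).

Lemma quat_eq (x y : Quat) :
  q_re x = q_re y -> q_i x = q_i y -> q_j x = q_j y -> q_k x = q_k y -> x = y.
Proof.
destruct x as [[[a b] c] d], y as [[[a' b'] c'] d'].
unfold q_re, q_i, q_j, q_k; simpl; intros; subst; reflexivity.
Qed.

Ltac quat_ring :=
  intros; apply quat_eq; unfold quat_mult, quat_of_R, q_re, q_i, q_j, q_k;
  simpl; unfold plus; simpl; ring.

Lemma quat_mult_assoc (x y z : Quat) :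
  quat_mult x (quat_mult y z) = quat_mult (quat_mult x y) z.
Proof. quat_ring. Qed.

Lemma quat_mult_1_r (x : Quat) : quat_mult x (quat_of_R 1) = x.
Proof. quat_ring. Qed.

Lemma quat_mult_1_l (x : Quat) : quat_mult (quat_of_R 1) x = x.
Proof. quat_ring. Qed.

Lemma quat_mult_plus_distr_r (x y z : Quat) :
  quat_mult (plus x y) z = plus (quat_mult x z) (quat_mult y z).
Proof. quat_ring. Qed.

Lemma quat_mult_plus_distr_l (x y z : Quat) :
  quat_mult x (plus y z) = plus (quat_mult x y) (quat_mult x z).
Proof. quat_ring. Qed.

Definition Quat_Ring_mixin :=
  Ring.Mixin Quat_AbelianGroup quat_mult (quat_of_R 1)
    quat_mult_assoc quat_mult_1_r quat_mult_1_l
    quat_mult_plus_distr_r quat_mult_plus_distr_l.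

Canonical Quat_Ring :=
  Ring.Pack Quat
    (Ring.Class Quat (AbelianGroup.class Quat_AbelianGroup) Quat_Ring_mixin)
    Quat.

Declare Scope quat_scope.
Delimit Scope quat_scope with quat.
Bind Scope quat_scope with Quat.
Notation "x + y" := (@plus Quat_AbelianGroup x y) : quat_scope.
Notation "x - y" := (@minus Quat_AbelianGroup x y) : quat_scope.
Notation "- x" := (@opp Quat_AbelianGroup x) : quat_scope.
Notation "x * y" := (@mult Quat_Ring x y) : quat_scope.
Notation "x ^ n" := (@pow_n Quat_Ring x n) : quat_scope.
Notation "a *: x" := (@scal R_Ring Quat_ModuleSpace a%R x)
  (at level 40, left associativity) : quat_scope.

Local Open Scope quat_scope.

Definition quat_conj (x : Quat) : Quat :=
  (q_re x, Ropp (q_i x), Ropp (q_j x), Ropp (q_k x)).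

Definition quat_norm (x : Quat) : R :=
  sqrt (q_re x ^ 2 + q_i x ^ 2 + q_j x ^ 2 + q_k x ^ 2)%R.

(* The norm of the product structure is the Euclidean one. *)
Lemma norm_quat (x : Quat) : norm x = quat_norm x.
Proof.
destruct x as [[[a b] c] d].
unfold quat_norm, q_re, q_i, q_j, q_k, norm; simpl; unfold prod_norm; simpl.
unfold norm; simpl; unfold prod_norm; simpl.
unfold norm; simpl; unfold prod_norm, norm; simpl.
unfold abs; simpl; rewrite !Rmult_1_r.
assert (E : forall t, (Rabs t * Rabs t = t * t)%R)
  by (intro t; rewrite <- Rabs_mult; apply Rabs_pos_eq, Rle_0_sqr).
rewrite !E.
assert (P : forall t, (0 <= t * t)%R) by (intro t; apply Rle_0_sqr).
assert (Pa := P a); assert (Pb := P b); assert (Pc := P c).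
rewrite !sqrt_sqrt; try reflexivity; try lra.
rewrite sqrt_sqrt; lra.
Qed.

Definition quat_Re (x : Quat) : Quat := (1 / 2) *: (x + quat_conj x).
Definition quat_Im (x : Quat) : Quat := (1 / 2) *: (x - quat_conj x).

Definition quat_is_real (x : Quat) : Prop := exists a : R, x = quat_of_R a.

Definition imag_unit (I : Quat) : Prop := I * I = quat_of_R (-1).

Definition slice_point (I : Quat) (z : C) : Quat :=
  quat_of_R (fst z) + I * quat_of_R (snd z).

Definition conj_invariant (D : C -> Prop) : Prop :=
  forall z, D z <-> D (Cconj z).

Definition circularization (D : C -> Prop) (x : Quat) : Prop :=
  exists (z : C) (I : Quat), D z /\ imag_unit I /\ x = slice_point I z.

(* The complexification of the quaternions: (a, b) stands for a + sqrt(-1) b. *)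
Definition QuatC : Type := (Quat * Quat)%type.

(* Functions on D are total functions of which only the values on D matter. *)
Definition is_stem (D : C -> Prop) (F : C -> QuatC) : Prop :=
  forall z, D z ->
    fst (F (Cconj z)) = fst (F z) /\ snd (F (Cconj z)) = - snd (F z).

Definition induces (D : C -> Prop) (F : C -> QuatC) (f : Quat -> Quat) : Prop :=
  forall z I, D z -> imag_unit I ->
    f (slice_point I z) = fst (F z) + I * snd (F z).

(* [G] is of class C^1 on [D], with partial derivatives [Ga] and [Gb] with
   respect to the real and the imaginary part of the variable. *)
Definition is_C1_with_partials (D : C -> Prop) (G Ga Gb : C -> Quat) : Prop :=
  forall z, D z ->
    is_derive (fun t : R => G (t, snd z)) (fst z) (Ga z) /\
    is_derive (fun t : R => G (fst z, t)) (snd z) (Gb z) /\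
    continuous Ga z /\ continuous Gb z.

Definition stem_C1_with_partials
    (D : C -> Prop) (F Fa Fb : C -> QuatC) : Prop :=
  is_C1_with_partials D
    (fun z => fst (F z)) (fun z => fst (Fa z)) (fun z => fst (Fb z)) /\
  is_C1_with_partials D
    (fun z => snd (F z)) (fun z => snd (Fa z)) (fun z => snd (Fb z)).

Definition slice_regular (D : C -> Prop) (f : Quat -> Quat) : Prop :=
  exists F Fa Fb : C -> QuatC,
    is_stem D F /\ stem_C1_with_partials D F Fa Fb /\
    (forall z, D z ->
       fst (Fa z) = snd (Fb z) /\ fst (Fb z) = - snd (Fa z)) /\
    induces D F f.

(* d/dz = 1/2 (d/da - sqrt(-1) d/db) on functions with values in [QuatC], in
   terms of the two partial derivatives. *)
Definition stem_dz (Fa Fb : C -> QuatC) (z : C) : QuatC :=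
  ((1 / 2) *: (fst (Fa z) + snd (Fb z)),
   (1 / 2) *: (snd (Fa z) - fst (Fb z))).

(* [df] is the slice derivative of [f] on the circularization of [D]. *)
Definition is_slice_derivative
    (D : C -> Prop) (f df : Quat -> Quat) : Prop :=
  exists F Fa Fb : C -> QuatC,
    is_stem D F /\ stem_C1_with_partials D F Fa Fb /\
    induces D F f /\ induces D (stem_dz Fa Fb) df.

Definition sph_delta (q0 x : Quat) : Quat :=
  x * x - 2 *: (x * quat_Re q0) + quat_of_R (quat_norm q0 ^ 2).

Definition sph_nbhd (q0 : Quat) (r : R) (x : Quat) : Prop :=
  quat_norm (sph_delta q0 x) < r ^ 2.

Definition spherical_coefficients
    (D : C -> Prop) (g : Quat -> Quat) (q0 : Quat) (c : nat -> Quat) : Prop :=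
  exists r : R, 0 < r /\
    (forall x, sph_nbhd q0 r x -> circularization D x) /\
    (forall x, sph_nbhd q0 r x ->
       is_series (fun n : nat =>
         sph_delta q0 x ^ n * (c (2 * n)%nat + (x - q0) * c (2 * n + 1)%nat))
         (g x)).

(* Main.v *)
(** Write [q0 = a + J b] and restrict everything to the points [x = a + J u] and
    [x = a - J u] with [u] real and close to [b].  There [Delta(x) = b^2 - u^2] is
    real, and [x - q0 = (+/-) J u - Im q0], so the even and odd parts in [J] of the
    spherical expansion express the two components of the stem function through
    real power series with quaternionic coefficients:
      [F0 = sum (b^2 - u^2)^n (s_2n - Im(q0) s_(2n+1))],
      [F1 = u sum (b^2 - u^2)^n s_(2n+1)].
    By the Cauchy-Riemann equations the stem function of the slice derivative has
    components [dF1/du] and [- dF0/du].  Termwise differentiation, coordinate by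
    coordinate, and uniqueness of power series coefficients give [s'_(2n+1)] and
    [s'_2n - Im(q0) s'_(2n+1)], from which [s'_2n] follows using
    [Im(q0)^2 = - b^2]. *)

Require Import Defs.
From Stdlib Require Import Reals Lra Lia.
From Coquelicot Require Import Coquelicot.
Open Scope R_scope.

(** * Real power series in the variable [b ^ 2 - u ^ 2] *)

Lemma CV_radius_pos_of_pseries (a : nat -> R) (x l : R) :
  x <> 0 -> is_pseries a x l -> Rbar_lt 0 (CV_radius a).
Proof.
intros Hx Ha.
apply Rbar_lt_le_trans with (Rabs x); [exact (Rabs_pos_lt x Hx)|].
apply Rbar_not_lt_le; intro Hlt.
apply (CV_disk_outside a x Hlt), ex_series_lim_0.
exists l; apply is_pseries_R; exact Ha.
Qed.

Lemma locally_0_exists_nonzero (P : R -> Prop) :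
  locally 0 P -> exists x, x <> 0 /\ P x.
Proof.
intros [eps Heps].
exists (eps / 2); destruct eps as [e He]; simpl in *.
split; [lra|].
apply Heps; unfold ball; simpl; unfold AbsRing_ball, abs, minus, plus, opp; simpl.
rewrite Rabs_pos_eq; lra.
Qed.

(** Convergence at a single nonzero point already makes both radii positive; the two sums agree near
    0, and a sum near 0 determines its coefficients. *)
Lemma pseries_coeff_unique (a b : nat -> R) :
  locally 0 (fun x => exists l, is_pseries a x l /\ is_pseries b x l) ->
  forall n, a n = b n.
Proof.
intros H n.
destruct (locally_0_exists_nonzero _ H) as [x [Hx [l [Ha Hb]]]].
apply PSeries_ext_recip.
- exact (CV_radius_pos_of_pseries a x l Hx Ha).
- exact (CV_radius_pos_of_pseries b x l Hx Hb).
- apply filter_imp with (2 := H); intros y [m [Hma Hmb]].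
  rewrite (is_pseries_unique a y m Hma), (is_pseries_unique b y m Hmb); reflexivity.
Qed.

(** Near [b] the map [u -> b ^ 2 - u ^ 2] has the continuous right inverse
    [d -> b * sqrt (1 - d / b ^ 2)], whose outer factor keeps the sign of [b]. This carries facts
    about [u] near [b] over to [d] near 0. *)
Lemma locally_square_gap (b : R) (P : R -> Prop) :
  b <> 0 -> locally b P ->
  locally 0 (fun d => exists u, b ^ 2 - u ^ 2 = d /\ u <> 0 /\ P u).
Proof.
intros Hb HP.
assert (Hb2 : 0 < b ^ 2) by (apply pow2_gt_0; exact Hb).
pose (g := fun d : R => b * sqrt (1 - d / b ^ 2)).
assert (g0 : g 0 = b).
{ unfold g; replace (1 - 0 / b ^ 2) with 1 by (field; lra).
  rewrite sqrt_1; ring. }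
assert (Hg : continuous g 0).
{ unfold g; apply (continuous_mult (fun _ => b)); [apply continuous_const|].
  apply (continuous_comp (fun d => 1 - d / b ^ 2) sqrt).
  - apply (ex_derive_continuous (fun d => 1 - d / b ^ 2)); auto_derive; lra.
  - apply continuous_sqrt. }
assert (HgP : locally 0 (fun d => P (g d))).
{ apply Hg; rewrite g0; exact HP. }
assert (Hlt : locally 0 (fun d => d < b ^ 2)) by (apply (open_lt (b ^ 2)); exact Hb2).
generalize (filter_and _ _ HgP Hlt); apply filter_imp; intros d [HPd Hd].
assert (Hpos : 0 < 1 - d / b ^ 2).
{ replace (1 - d / b ^ 2) with ((b ^ 2 - d) / b ^ 2) by (field; lra).
  apply Rdiv_lt_0_compat; lra. }
exists (g d); split; [|split; [|exact HPd]].
- unfold g; rewrite Rpow_mult_distr, pow2_sqrt by lra; field; lra.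
- unfold g; apply Rmult_integral_contrapositive; split; [exact Hb|].
  apply Rgt_not_eq, sqrt_lt_R0; exact Hpos.
Qed.

Lemma square_gap_in_disk (b : R) (r : Rbar) :
  Rbar_lt 0 r -> locally b (fun u => Rbar_lt (Rabs (b ^ 2 - u ^ 2)) r).
Proof.
intros Hr.
assert (Hc : continuous (fun u => Rabs (b ^ 2 - u ^ 2)) b).
{ apply (continuous_comp (fun u => b ^ 2 - u ^ 2) Rabs).
  - apply (ex_derive_continuous (fun u => b ^ 2 - u ^ 2)); auto_derive; exact I.
  - apply continuous_Rabs. }
apply (Hc (fun y => Rbar_lt y r)).
replace (b ^ 2 - b ^ 2) with 0 by ring; rewrite Rabs_R0.
exact (open_Rbar_lt' (Finite 0) r Hr).
Qed.

Lemma CV_radius_pos_of_square_gap (b : R) (a : nat -> R) (l : R -> R) :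
  b <> 0 -> locally b (fun u => is_pseries a (b ^ 2 - u ^ 2) (l u)) ->
  Rbar_lt 0 (CV_radius a).
Proof.
intros Hb Ha.
destruct (locally_0_exists_nonzero _ (locally_square_gap b _ Hb Ha))
  as [x [Hx [u [Hu [_ Hau]]]]].
rewrite Hu in Hau.
exact (CV_radius_pos_of_pseries a x (l u) Hx Hau).
Qed.

Lemma pseries_coeff_unique_square_gap (b : R) (a c : nat -> R) :
  b <> 0 ->
  locally b (fun u => u <> 0 -> exists l,
    is_pseries a (b ^ 2 - u ^ 2) l /\ is_pseries c (b ^ 2 - u ^ 2) l) ->
  forall n, a n = c n.
Proof.
intros Hb H; apply pseries_coeff_unique.
generalize (locally_square_gap b _ Hb H).
apply filter_imp; intros d [u [<- [Hu HP]]]; exact (HP Hu).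
Qed.

(** * Termwise differentiation in [u] *)

Lemma is_derive_PSeries_square_gap (b u : R) (a : nat -> R) :
  Rbar_lt (Rabs (b ^ 2 - u ^ 2)) (CV_radius a) ->
  is_derive (fun t => PSeries a (b ^ 2 - t ^ 2)) u
    (- 2 * u * PSeries (PS_derive a) (b ^ 2 - u ^ 2)).
Proof.
intros Hr.
apply (is_derive_comp (PSeries a) (fun t => b ^ 2 - t ^ 2)).
- exact (is_derive_PSeries a _ Hr).
- auto_derive; [exact I|ring].
Qed.

(* On the line [x = a + J u], writing [d = b^2 - u^2], the components of the stem
   function are [P(d)] and [u Q(d)] for power series [P] and [Q]; with [d' = - 2 u],
   differentiating them gives [- 2 u P'(d)] and [Q(d) - 2 (b^2 - d) Q'(d)]. *)
Lemma even_part_derivative_coeff (b : R) (P K : nat -> R) (F F' : R -> R) :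
  b <> 0 ->
  locally b (fun u => is_derive F u (F' u)) ->
  locally b (fun u => is_pseries P (b ^ 2 - u ^ 2) (F u)) ->
  locally b (fun u => u <> 0 -> is_pseries K (b ^ 2 - u ^ 2) (/ u * - F' u)) ->
  forall n, K n = 2 * INR (S n) * P (S n).
Proof.
intros Hb HF HP HK n.
assert (Hrad := CV_radius_pos_of_square_gap b P F Hb HP).
(* Reassociated, the right side is by conversion the [n]-th coefficient of
   [PS_scal 2 (PS_derive P)]. *)
rewrite Rmult_assoc.
apply (pseries_coeff_unique_square_gap b K (PS_scal 2 (PS_derive P)) Hb).
(* Differentiating at [u] needs the series formula on a whole neighbourhood of [u], hence
   [locally_locally]. *)
generalize (filter_and _ _ HF (filter_and _ _ HK (filter_and _ _
  (locally_locally _ _ HP) (square_gap_in_disk b _ Hrad)))).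
apply filter_imp; intros u [dF [Ku [PF Hr]]] Hu.
exists (/ u * - F' u); split; [exact (Ku Hu)|].
assert (E : F' u = - 2 * u * PSeries (PS_derive P) (b ^ 2 - u ^ 2)).
{ rewrite <- (is_derive_unique _ _ _ dF).
  apply is_derive_unique.
  apply is_derive_ext_loc with (2 := is_derive_PSeries_square_gap b u P Hr).
  apply filter_imp with (2 := PF); intros t; apply is_pseries_unique. }
rewrite E.
replace (/ u * - (- 2 * u * PSeries (PS_derive P) (b ^ 2 - u ^ 2)))
  with (2 * PSeries (PS_derive P) (b ^ 2 - u ^ 2)) by (field; exact Hu).
apply (is_pseries_scal (2 : R_AbsRing) (PS_derive P)); [apply Rmult_comm|].
apply PSeries_correct, CV_radius_inside; rewrite CV_radius_derive; exact Hr.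
Qed.

Lemma odd_part_derivative_coeff (b : R) (Q H : nat -> R) (F F' : R -> R) :
  b <> 0 ->
  locally b (fun u => is_derive F u (F' u)) ->
  locally b (fun u => u <> 0 -> is_pseries Q (b ^ 2 - u ^ 2) (/ u * F u)) ->
  locally b (fun u => is_pseries H (b ^ 2 - u ^ 2) (F' u)) ->
  forall n, H n = (2 * INR n + 1) * Q n - 2 * b ^ 2 * (INR (S n) * Q (S n)).
Proof.
intros Hb HF HQ HH n.
assert (Hnz : locally b (fun u => u <> 0)) by (apply (open_neq 0); exact Hb).
assert (HQ' : locally b (fun u => is_pseries Q (b ^ 2 - u ^ 2) (/ u * F u))).
{ generalize (filter_and _ _ HQ Hnz); apply filter_imp; tauto. }
assert (Hrad := CV_radius_pos_of_square_gap b Q _ Hb HQ').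
(* Coefficients of [Q(d) - 2 b^2 Q'(d) + 2 d Q'(d)]; the shift [PS_incr_1] is multiplication by
   [d]. *)
pose (c := PS_plus Q (PS_plus (PS_scal (- 2 * b ^ 2) (PS_derive Q))
                              (PS_scal 2 (PS_incr_1 (PS_derive Q))))).
replace ((2 * INR n + 1) * Q n - 2 * b ^ 2 * (INR (S n) * Q (S n))) with (c n).
2: { unfold c, PS_plus, PS_scal, PS_incr_1, PS_derive, plus, scal, mult, zero; simpl.
     unfold mult; simpl.
     (* The shifted series has constant coefficient 0, which agrees with [2 * INR n * Q n] at
        [n = 0]. *)
     destruct n as [|n]; [simpl; ring|].
     change (match n with 0%nat => 1 | S _ => INR n + 1 end) with (INR (S n)); ring. }
apply (pseries_coeff_unique_square_gap b H c Hb).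
generalize (filter_and _ _ HF (filter_and _ _ HH (filter_and _ _
  (locally_locally _ _ (filter_and _ _ HQ' Hnz)) (square_gap_in_disk b _ Hrad)))).
apply filter_imp; intros u [dF [Hu [QF Hr]]] Hu0.
exists (F' u); split; [exact Hu|].
set (d := b ^ 2 - u ^ 2) in *.
assert (E : F' u = PSeries Q d + (- 2 * b ^ 2 * PSeries (PS_derive Q) d
                     + 2 * (d * PSeries (PS_derive Q) d))).
{ rewrite <- (is_derive_unique _ _ _ dF).
  apply is_derive_unique.
  apply is_derive_ext_loc with (fun t => t * PSeries Q (b ^ 2 - t ^ 2)).
  - apply filter_imp with (2 := QF); intros t [Ht Ht0].
    rewrite (is_pseries_unique _ _ _ Ht); change (t * (/ t * F t) = F t); field; exact Ht0.
  - evar_last.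
    + apply (is_derive_mult (fun t : R => t)).
      * apply is_derive_id.
      * exact (is_derive_PSeries_square_gap b u Q Hr).
      * apply Rmult_comm.
    + change (1 * PSeries Q d + u * (- 2 * u * PSeries (PS_derive Q) d) =
              PSeries Q d + (- 2 * b ^ 2 * PSeries (PS_derive Q) d
                 + 2 * (d * PSeries (PS_derive Q) d))).
      generalize (PSeries Q d), (PSeries (PS_derive Q) d); intros; unfold d; ring. }
rewrite E.
assert (HQd : is_pseries Q d (PSeries Q d))
  by (apply PSeries_correct, CV_radius_inside; exact Hr).
assert (HQ'd : is_pseries (PS_derive Q) d (PSeries (PS_derive Q) d))
  by (apply PSeries_correct, CV_radius_inside; rewrite CV_radius_derive; exact Hr).
apply (is_pseries_plus Q _ d _ _ HQd).
apply (is_pseries_plus (V := R_NormedModule) _ _ d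
         (- 2 * b ^ 2 * PSeries (PS_derive Q) d) (2 * (d * PSeries (PS_derive Q) d))).
- apply (is_pseries_scal (K := R_AbsRing) (V := R_NormedModule)); [apply Rmult_comm|exact HQ'd].
- apply (is_pseries_scal (K := R_AbsRing) (V := R_NormedModule)); [apply Rmult_comm|].
  exact (is_pseries_incr_1 _ _ _ HQ'd).
Qed.

(** * Quaternion arithmetic at slice points *)

Ltac quat_unfold_operations :=
  repeat match goal with
  | |- context [@mult Quat_Ring ?x ?y] =>
      change (@mult Quat_Ring x y) with (quat_mult x y)
  | |- context [@plus _ ?x ?y] =>
      change (plus x y) with
        (q_re x + q_re y, q_i x + q_i y, q_j x + q_j y, q_k x + q_k y)
  | |- context [@opp _ ?x] =>
      change (opp x) with (- q_re x, - q_i x, - q_j x, - q_k x)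
  | |- context [@scal _ _ ?a ?x] =>
      change (scal a x) with (a * q_re x, a * q_i x, a * q_j x, a * q_k x)
  end.

Ltac quat_coords :=
  unfold quat_Re, quat_Im, sph_delta, slice_point, minus;
  quat_unfold_operations;
  apply quat_eq;
  cbv beta iota delta [quat_mult quat_conj quat_of_R q_re q_i q_j q_k fst snd].

Ltac quat_solve :=
  intros;
  repeat match goal with x : Quat |- _ => destruct x as [[[? ?] ?] ?] end;
  quat_coords; field.

Lemma imag_unit_opp (I : Quat) : imag_unit I -> imag_unit (- I)%quat.
Proof. unfold imag_unit; intros <-; quat_solve. Qed.

(** If the real part [p] were nonzero, the imaginary coordinates of [I * I], which are [2 p] times
    those of [I], would force [I] to be real with [p ^ 2 = -1]. The norm condition is solved for one
    square so that it can serve as a rewriting rule for [ring]. *)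
Lemma imag_unit_coords (I : Quat) :
  imag_unit I ->
  q_re I = 0 /\ q_i I * q_i I = 1 - q_j I * q_j I - q_k I * q_k I.
Proof.
destruct I as [[[p x] y] z]; unfold imag_unit; quat_unfold_operations.
unfold quat_mult, quat_of_R, q_re, q_i, q_j, q_k; simpl; intros H.
injection H as H0 H1 H2 H3.
assert (p = 0); [|split; nra].
destruct (Req_dec p 0) as [Hp|Hp]; [exact Hp|exfalso].
assert (x = 0) by (apply (Rmult_eq_reg_l p); lra).
assert (y = 0) by (apply (Rmult_eq_reg_l p); lra).
assert (z = 0) by (apply (Rmult_eq_reg_l p); lra).
subst; nra.
Qed.

Ltac imag_unit_destruct H :=
  match type of H with imag_unit ?I =>
    apply imag_unit_coords in H; destruct I as [[[? ?] ?] ?];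
    unfold q_re, q_i, q_j, q_k in H; simpl in H;
    let H' := fresh in destruct H as [H' H]; subst
  end.

Lemma quat_Im_slice_point (I : Quat) (z : C) :
  imag_unit I -> quat_Im (slice_point I z) = (snd z *: I)%quat.
Proof.
intros HI; imag_unit_destruct HI; quat_coords; field.
Qed.

Lemma quat_Re_slice_point (I : Quat) (z : C) :
  imag_unit I -> quat_Re (slice_point I z) = quat_of_R (fst z).
Proof.
intros HI; imag_unit_destruct HI; quat_coords; field.
Qed.

Lemma quat_norm_sqr (x : Quat) :
  quat_norm x ^ 2 = q_re x ^ 2 + q_i x ^ 2 + q_j x ^ 2 + q_k x ^ 2.
Proof.
unfold quat_norm; apply pow2_sqrt.
repeat apply Rplus_le_le_0_compat; apply pow2_ge_0.
Qed.

Lemma quat_norm_mult (x y : Quat) :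
  quat_norm (x * y)%quat = quat_norm x * quat_norm y.
Proof.
unfold quat_norm; rewrite <- sqrt_mult;
  [|repeat apply Rplus_le_le_0_compat; apply pow2_ge_0..].
f_equal; quat_unfold_operations; unfold quat_mult, q_re, q_i, q_j, q_k; simpl; ring.
Qed.

Lemma quat_norm_of_R (a : R) : quat_norm (quat_of_R a) = Rabs a.
Proof.
unfold quat_norm, quat_of_R, q_re, q_i, q_j, q_k; simpl.
rewrite <- sqrt_Rsqr_abs; f_equal; unfold Rsqr; ring.
Qed.

Lemma quat_norm_slice_point_sqr (I : Quat) (z : C) :
  imag_unit I -> quat_norm (slice_point I z) ^ 2 = fst z ^ 2 + snd z ^ 2.
Proof.
intros HI; rewrite quat_norm_sqr; imag_unit_destruct HI.
unfold slice_point; quat_unfold_operations.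
unfold quat_mult, quat_of_R, q_re, q_i, q_j, q_k; simpl; ring [HI].
Qed.

(** Both points have real part [a], so [sph_delta] is [(x - a)^2 + b^2] with [x - a = I u]. *)
Lemma sph_delta_slice_point (I J : Quat) (a b u : R) :
  imag_unit I -> imag_unit J ->
  sph_delta (slice_point J (a, b)) (slice_point I (a, u)) =
  quat_of_R (b ^ 2 - u ^ 2).
Proof.
intros HI HJ; unfold sph_delta.
rewrite (quat_Re_slice_point _ _ HJ), (quat_norm_slice_point_sqr _ _ HJ).
imag_unit_destruct HI; quat_coords; ring [HI].
Qed.

Lemma pow_quat_of_R_mult (d : R) (n : nat) (x : Quat) :
  (quat_of_R d ^ n * x)%quat = (pow_n d n *: x)%quat.
Proof.
revert x; induction n as [|n IH]; intros x; simpl.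
- rewrite mult_one_l; symmetry; apply scal_one.
- rewrite <- mult_assoc, IH.
  change (mult d (pow_n d n)) with (d * pow_n d n).
  generalize (pow_n d n); quat_solve.
Qed.

(** * Real-linear maps, series and derivatives *)

Lemma is_linear_quat_mult (q : Quat) : is_linear (fun x : Quat => (q * x)%quat).
Proof.
split.
- intros x y; quat_solve.
- intros k x; revert k; quat_solve.
(* The added 1 keeps the bound strictly positive, as [is_linear] demands, even for [q = 0]. *)
- exists (quat_norm q + 1); split.
  + assert (0 <= quat_norm q) by apply sqrt_pos; lra.
  + intros x; rewrite !norm_quat, quat_norm_mult.
    assert (0 <= quat_norm x) by apply sqrt_pos.
    apply Rmult_le_compat_r; lra.
Qed.

(** The four coordinates are themselves continuous linear functionals. This reduces identities
    between quaternionic coefficients to real power series. *)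
Lemma quat_linear_ext (x y : Quat) :
  (forall l : Quat -> R, is_linear l -> l x = l y) -> x = y.
Proof.
assert (L1 : is_linear (fun x : Quat => fst (fst x)))
  by (apply (is_linear_comp (U := Quat_NormedModule) fst fst); apply is_linear_fst).
intros H; apply quat_eq; apply H.
- apply (is_linear_comp (U := Quat_NormedModule) _ fst L1), is_linear_fst.
- apply (is_linear_comp (U := Quat_NormedModule) _ snd L1), is_linear_snd.
- apply (is_linear_comp (U := Quat_NormedModule) fst snd);
    [apply is_linear_fst|apply is_linear_snd].
- apply is_linear_snd.
Qed.

Lemma is_pseries_linear {K : AbsRing} {U V : NormedModule K} (l : U -> V)
    (a : nat -> U) (x : K) (y : U) :
  is_linear l -> is_pseries a x y -> is_pseries (fun n => l (a n)) x (l y).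
Proof.
intros Hl Ha; unfold is_pseries, is_series in *.
apply filterlim_ext with (fun n => l (sum_n (fun k => scal (pow_n x k) (a k)) n)).
- intros m; induction m as [|n IH].
  + rewrite !sum_O; apply linear_scal; exact Hl.
  + rewrite !sum_Sn, (linear_plus _ Hl), IH; f_equal; apply linear_scal; exact Hl.
- apply filterlim_comp with (1 := Ha); apply (linear_cont l y Hl).
Qed.

Lemma is_derive_linear {K : AbsRing} {U V : NormedModule K} (l : U -> V)
    (f : K -> U) (x : K) (df : U) :
  is_linear l -> is_derive f x df -> is_derive (fun t => l (f t)) x (l df).
Proof.
intros Hl Hf.
apply filterdiff_ext_lin with (fun y => l (scal y df)).
- apply (filterdiff_comp' f l x _ l Hf); apply filterdiff_linear; exact Hl.
- intros y; apply linear_scal; exact Hl.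
Qed.

Lemma is_derive_quat_unique (f : R -> Quat) (x : R) (l1 l2 : Quat) :
  is_derive f x l1 -> is_derive f x l2 -> l1 = l2.
Proof.
intros H1 H2; apply quat_linear_ext; intros l Hl.
rewrite <- (is_derive_unique _ _ _ (is_derive_linear l f x l1 Hl H1)).
apply is_derive_unique, is_derive_linear; assumption.
Qed.

(** * Stem functions and the stem of the slice derivative *)

Lemma slice_even_part (J y w : Quat) :
  ((1 / 2) *: ((y + J * w) + (y + - J * w)))%quat = y.
Proof. quat_solve. Qed.

Lemma slice_odd_part (J y w : Quat) :
  imag_unit J ->
  (- (1 / 2) *: (J * ((y + J * w) - (y + - J * w))))%quat = w.
Proof.
intros HJ.
(* The left side is [J * J * (- w)]; writing -1 as a quaternion lets the hypothesis on [J] enter. *)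
transitivity (quat_of_R (-1) * (- w))%quat.
- rewrite <- HJ; quat_solve.
- quat_solve.
Qed.

Lemma induces_at_conjugate_points (D : C -> Prop) (F : C -> QuatC) (f : Quat -> Quat)
    (J : Quat) (z : C) :
  induces D F f -> D z -> imag_unit J ->
  f (slice_point J z) = (fst (F z) + J * snd (F z))%quat /\
  f (slice_point (- J)%quat z) = (fst (F z) + - J * snd (F z))%quat.
Proof.
intros HF Dz HJ; split; apply HF; trivial; apply imag_unit_opp; exact HJ.
Qed.

(** The values of [f] at the points with units [J] and [- J] recover both components, as even and
    odd parts in [J]. *)
Lemma inducing_stem_unique (D : C -> Prop) (F G : C -> QuatC) (f : Quat -> Quat)
    (J : Quat) (z : C) :
  imag_unit J -> induces D F f -> induces D G f -> D z ->
  fst (F z) = fst (G z) /\ snd (F z) = snd (G z).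
Proof.
intros HJ HF HG Dz.
destruct (induces_at_conjugate_points D F f J z HF Dz HJ) as [F1 F2].
destruct (induces_at_conjugate_points D G f J z HG Dz HJ) as [G1 G2].
split.
- rewrite <- (slice_even_part J (fst (F z)) (snd (F z))).
  rewrite <- (slice_even_part J (fst (G z)) (snd (G z))).
  rewrite <- F1, <- F2, <- G1, <- G2; reflexivity.
- rewrite <- (slice_odd_part J (fst (F z)) (snd (F z)) HJ).
  rewrite <- (slice_odd_part J (fst (G z)) (snd (G z)) HJ).
  rewrite <- F1, <- F2, <- G1, <- G2; reflexivity.
Qed.

Lemma open_horizontal (D : C -> Prop) (a u : R) :
  open D -> D (a, u) -> locally a (fun t => D (t, u)).
Proof.
intros HD Hz; destruct (HD _ Hz) as [eps Heps].
exists eps; intros t Ht; apply Heps; split; [exact Ht|apply ball_center].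
Qed.

Lemma open_vertical (D : C -> Prop) (a u : R) :
  open D -> D (a, u) -> locally u (fun t => D (a, t)).
Proof.
intros HD Hz; destruct (HD _ Hz) as [eps Heps].
exists eps; intros t Ht; apply Heps; split; [apply ball_center|exact Ht].
Qed.

Lemma C1_partials_ext (D : C -> Prop) (G Ga Gb H Ha Hb : C -> Quat) (z : C) :
  open D -> (forall z, D z -> G z = H z) ->
  is_C1_with_partials D G Ga Gb -> is_C1_with_partials D H Ha Hb -> D z ->
  Ga z = Ha z /\ Gb z = Hb z.
Proof.
destruct z as [a u]; intros HD GH HG HH Dz.
destruct (HG _ Dz) as [Ga' [Gb' _]]; destruct (HH _ Dz) as [Ha' [Hb' _]].
simpl in Ga', Gb', Ha', Hb'.
split; eapply is_derive_quat_unique; [|exact Ha'| |exact Hb'].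
- apply is_derive_ext_loc with (2 := Ga').
  apply filter_imp with (2 := open_horizontal D a u HD Dz); intros t; apply GH.
- apply is_derive_ext_loc with (2 := Gb').
  apply filter_imp with (2 := open_vertical D a u HD Dz); intros t; apply GH.
Qed.

(** Regularity and the slice derivative each supply a stem function; uniqueness identifies the two
    and their partials on [D]. The Cauchy-Riemann equations then leave only derivatives in the
    imaginary direction, computable along the line of real part [a]. *)
Lemma slice_derivative_stem (D : C -> Prop) (f df : Quat -> Quat) (J : Quat) :
  open D -> imag_unit J -> slice_regular D f -> is_slice_derivative D f df ->
  exists F Fa Fb : C -> QuatC,
    stem_C1_with_partials D F Fa Fb /\ induces D F f /\
    induces D (fun z => (snd (Fb z), - fst (Fb z)))%quat df.
Proof.
intros HD HJ [F [Fa [Fb [_ [HF [CR Ff]]]]]] [G [Ga [Gb [_ [HG [Gf Gdf]]]]]].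
exists F, Fa, Fb; split; [exact HF|split; [exact Ff|]].
intros z I Dz HI; rewrite (Gdf z I Dz HI).
destruct HF as [HF0 HF1]; destruct HG as [HG0 HG1].
assert (FG := fun z => inducing_stem_unique D F G f J z HJ Ff Gf).
destruct (C1_partials_ext D _ _ _ _ _ _ z HD (fun z Dz => proj1 (FG z Dz)) HF0 HG0 Dz)
  as [Ea0 Eb0].
destruct (C1_partials_ext D _ _ _ _ _ _ z HD (fun z Dz => proj2 (FG z Dz)) HF1 HG1 Dz)
  as [Ea1 Eb1].
destruct (CR z Dz) as [CR0 CR1].
unfold stem_dz; rewrite <- Ea0, <- Eb0, <- Ea1, <- Eb1, CR0, CR1; simpl.
generalize (snd (Fa z)), (snd (Fb z)); quat_solve.
Qed.

(** * The spherical expansion restricted to a slice *)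

Lemma sph_term_slice_point (I J c0 c1 : Quat) (a b u : R) (n : nat) :
  imag_unit I -> imag_unit J ->
  let q0 := slice_point J (a, b) in
  (sph_delta q0 (slice_point I (a, u)) ^ n
     * (c0 + (slice_point I (a, u) - q0) * c1))%quat =
  (pow_n (b ^ 2 - u ^ 2)%R n *: (c0 - quat_Im q0 * c1 + I * (u *: c1)))%quat.
Proof.
intros HI HJ q0; unfold q0.
rewrite (sph_delta_slice_point I J a b u HI HJ), pow_quat_of_R_mult.
(* What remains is [x - q0 = I u - J b], where [J b] is the imaginary part of [q0]. *)
rewrite (quat_Im_slice_point J _ HJ); clear HI HJ; clear q0; f_equal.
revert a b u; quat_solve.
Qed.

Lemma spherical_series_on_slice (D : C -> Prop) (F : C -> QuatC) (g : Quat -> Quat)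
    (J : Quat) (a b : R) (c : nat -> Quat) :
  open D -> imag_unit J -> D (a, b) -> induces D F g ->
  spherical_coefficients D g (slice_point J (a, b)) c ->
  locally b (fun u => D (a, u) /\
    is_pseries (fun n => c (2 * n)%nat
        - quat_Im (slice_point J (a, b)) * c (2 * n + 1)%nat)%quat
      (b ^ 2 - u ^ 2) (fst (F (a, u))) /\
    (u <> 0 -> is_pseries (fun n => c (2 * n + 1)%nat)
      (b ^ 2 - u ^ 2) (/ u *: snd (F (a, u)))%quat)).
Proof.
intros HD HJ Dab HF [r [Hr [_ Hc]]].
(* Since [sph_delta] is the real number [b ^ 2 - u ^ 2] here, this bound is membership in
   [sph_nbhd]. *)
assert (Hgap : locally b (fun u => Rabs (b ^ 2 - u ^ 2) < r ^ 2)).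
{ exact (square_gap_in_disk b (r ^ 2) (pow_lt r 2 Hr)). }
generalize (filter_and _ _ (open_vertical D a b HD Dab) Hgap).
apply filter_imp; intros u [Du Hu]; split; [exact Du|].
destruct (induces_at_conjugate_points D F g J (a, u) HF Du HJ) as [E1 E2].
assert (series : forall I, imag_unit I ->
  is_pseries (fun n => c (2 * n)%nat
        - quat_Im (slice_point J (a, b)) * c (2 * n + 1)%nat
        + I * (u *: c (2 * n + 1)%nat))%quat (b ^ 2 - u ^ 2) (g (slice_point I (a, u)))).
{ intros I HI.
  unfold is_pseries.
  eapply is_series_ext.
  { intros n.
    exact (sph_term_slice_point I J (c (2 * n)%nat) (c (2 * n + 1)%nat) a b u n HI HJ). }
  apply Hc; unfold sph_nbhd.
  apply Rle_lt_trans with (2 := Hu), Req_le.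
  etransitivity; [exact (f_equal quat_norm (sph_delta_slice_point I J a b u HI HJ))|].
  apply quat_norm_of_R. }
assert (S1 := series _ HJ); assert (S2 := series _ (imag_unit_opp J HJ)).
rewrite E1 in S1; rewrite E2 in S2.
split.
- rewrite <- (slice_even_part J (fst (F (a, u))) (snd (F (a, u)))).
  eapply is_pseries_ext;
    [|apply (is_pseries_scal (V := Quat_NormedModule) (1 / 2));
      [apply Rmult_comm|exact (is_pseries_plus _ _ _ _ _ S1 S2)]].
  intros n; apply slice_even_part.
- intros Hu0.
  (* Left multiplication by [J] and scaling by -1/2 extract the odd part as in [slice_odd_part];
     division by [u] then removes the factor [u] from its coefficients. *)
  assert (S3 := is_pseries_linear (U := Quat_NormedModule) (V := Quat_NormedModule)
    _ _ _ _ (is_linear_quat_mult J) (is_pseries_minus _ _ _ _ _ S1 S2)).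
  assert (S4 := is_pseries_scal (- (1 / 2) : R_AbsRing) _ _ _ (Rmult_comm _ _) S3).
  assert (S5 := is_pseries_scal (/ u : R_AbsRing) _ _ _ (Rmult_comm _ _) S4).
  rewrite <- (slice_odd_part J (fst (F (a, u))) (snd (F (a, u))) HJ).
  apply is_pseries_ext with (2 := S5).
  intros n; unfold PS_scal.
  etransitivity; [apply f_equal, (slice_odd_part J _ _ HJ)|].
  etransitivity; [apply (scal_assoc (V := Quat_ModuleSpace))|].
  etransitivity; [|apply (scal_one (V := Quat_ModuleSpace))].
  f_equal; apply Rinv_l; exact Hu0.
Qed.

(** * The coefficient formulas *)

Lemma slice_point_nonreal (I : Quat) (z : C) :
  ~ quat_is_real (slice_point I z) -> snd z <> 0.
Proof.
destruct z as [a b]; intros H Hb; apply H; exists a; simpl in Hb; subst.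
quat_solve.
Qed.

Theorem theorem5p1 (D : C -> Prop) (f df : Quat -> Quat) (q0 : Quat)
    (s s' : nat -> Quat)
    (D_open : open D) (D_conj : conj_invariant D)
    (f_regular : slice_regular D f)
    (df_deriv : is_slice_derivative D f df)
    (q0_in : circularization D q0) (q0_nonreal : ~ quat_is_real q0)
    (s_coef : spherical_coefficients D f q0 s)
    (s'_coef : spherical_coefficients D df q0 s') :
  forall k : nat,
    s' (2 * k)%nat =
      (INR (2 * k + 1) *: s (2 * k + 1)%nat
       + INR (2 * (k + 1)) *: (quat_Im q0 * s (2 * k + 2)%nat))%quat /\
    s' (2 * k + 1)%nat =
      (INR (2 * k + 2) *: s (2 * k + 2)%nat
       - INR (2 * (k + 1)) *: (quat_Im q0 * s (2 * k + 3)%nat))%quat.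
Proof.
destruct q0_in as [[a b] [J [Dab [HJ ->]]]].
assert (Hb := slice_point_nonreal _ _ q0_nonreal); simpl in Hb.
destruct (slice_derivative_stem D f df J D_open HJ f_regular df_deriv)
  as [F [Fa [Fb [[HF0 HF1] [Ff Fdf]]]]].
assert (Sf := spherical_series_on_slice D F f J a b s D_open HJ Dab Ff s_coef).
assert (Sdf := spherical_series_on_slice D _ df J a b s' D_open HJ Dab Fdf s'_coef).
simpl in Sdf.
assert (Hv := quat_Im_slice_point J (a, b) HJ); simpl in Hv.
set (v := quat_Im (slice_point J (a, b))) in *; clearbody v.
(* The second stem component of [df] is minus the [u]-derivative of the first component of [f];
   dividing it by [u] leaves the series of the odd coefficients. *)
assert (odd_coeff : forall n, s' (2 * n + 1)%nat =
  ((2 * INR (S n)) *: (s (2 * S n)%nat - v * s (2 * S n + 1)%nat))%quat).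
{ intros n; apply quat_linear_ext; intros l Hl.
  rewrite (linear_scal _ Hl).
  apply (even_part_derivative_coeff b
           (fun n => l (s (2 * n)%nat - v * s (2 * n + 1)%nat)%quat)
           (fun n => l (s' (2 * n + 1)%nat))
           (fun u => l (fst (F (a, u)))) (fun u => l (fst (Fb (a, u)))) Hb).
  - apply filter_imp with (2 := Sf); intros u [Du _].
    apply (is_derive_linear l (fun u => fst (F (a, u))) u _ Hl).
    apply (HF0 (a, u) Du).
  - apply filter_imp with (2 := Sf); intros u [_ [H _]].
    exact (is_pseries_linear l _ _ _ Hl H).
  - apply filter_imp with (2 := Sdf); intros u [_ [_ H]] Hu.
    replace (/ u * - l (fst (Fb (a, u)))) with (l (/ u *: - fst (Fb (a, u)))%quat).
    + exact (is_pseries_linear l _ _ _ Hl (H Hu)).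
    + transitivity (l (- / u *: fst (Fb (a, u)))%quat).
      { f_equal; generalize (/ u), (fst (Fb (a, u))); clear; quat_solve. }
      rewrite (linear_scal _ Hl).
      change (- / u * l (fst (Fb (a, u))) = / u * - l (fst (Fb (a, u)))); ring. }
(* The first stem component of [df] is the [u]-derivative of the second component of [f], which is
   [u] times a series in [b ^ 2 - u ^ 2]. *)
assert (even_coeff : forall n, (s' (2 * n)%nat - v * s' (2 * n + 1)%nat)%quat =
  ((2 * INR n + 1) *: s (2 * n + 1)%nat
   + (- (2 * b ^ 2 * INR (S n))) *: s (2 * S n + 1)%nat)%quat).
{ intros n; apply quat_linear_ext; intros l Hl.
  rewrite (linear_plus _ Hl), !(linear_scal _ Hl).
  etransitivity.
  - apply (odd_part_derivative_coeff b
           (fun n => l (s (2 * n + 1)%nat))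
           (fun n => l (s' (2 * n)%nat - v * s' (2 * n + 1)%nat)%quat)
           (fun u => l (snd (F (a, u)))) (fun u => l (snd (Fb (a, u)))) Hb).
    + apply filter_imp with (2 := Sf); intros u [Du _].
      apply (is_derive_linear l (fun u => snd (F (a, u))) u _ Hl).
      apply (HF1 (a, u) Du).
    + apply filter_imp with (2 := Sf); intros u [_ [_ H]] Hu.
      rewrite <- (linear_scal _ Hl (/ u)).
      exact (is_pseries_linear l _ _ _ Hl (H Hu)).
    + apply filter_imp with (2 := Sdf); intros u [_ [H _]].
      exact (is_pseries_linear l _ _ _ Hl H).
  - unfold plus, scal; simpl; unfold mult; simpl; ring. }
assert (Hvv : forall x, (v * (v * x) = (- b ^ 2) *: x)%quat).
{ intros x.
  transitivity (b ^ 2 *: (J * J * x))%quat.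
  - rewrite Hv; quat_solve.
  - rewrite HJ; quat_solve. }
intros k.
replace (2 * k + 2)%nat with (2 * S k)%nat by lia.
replace (2 * k + 3)%nat with (2 * S k + 1)%nat by lia.
replace (2 * (k + 1))%nat with (2 * S k)%nat by lia.
rewrite odd_coeff, plus_INR, !mult_INR; change (INR 2) with 2; change (INR 1) with 1.
split.
- transitivity ((s' (2 * k)%nat - v * s' (2 * k + 1)%nat) + v * s' (2 * k + 1)%nat)%quat.
  { generalize (s' (2 * k)%nat), (v * s' (2 * k + 1)%nat)%quat; quat_solve. }
  rewrite even_coeff, odd_coeff.
  generalize (INR k), (INR (S k)), (s (2 * k + 1)%nat), (s (2 * S k)%nat).
  intros m m' x y; specialize (Hvv (s (2 * S k + 1)%nat)).
  revert Hvv; generalize (s (2 * S k + 1)%nat); intros z Hz.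
  (* Isolating [v * (v * z)], which is [- b ^ 2] times [z], makes the two terms in [z], the
     coefficient of index [2k+3], cancel. *)
  transitivity (m' *: (2 *: (v * y) + (-2) *: (v * (v * z)))
                + ((2 * m + 1) *: x + (- (2 * b ^ 2 * m')) *: z))%quat.
  + clear; revert m m' b; quat_solve.
  + rewrite Hz; clear; quat_solve.
- generalize (INR (S k)), (s (2 * S k)%nat), (v * s (2 * S k + 1)%nat)%quat.
  clear; quat_solve.
Qed.
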